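(* Let $G$ be a graph with $n$ vertices $v_1,\dots,v_n$, where $v_i$ has degree $d_i$, and let $L$ be a list assignment on $G$ in which the list $L(v_i)$ has size $k_i$ (the lists may have different sizes). If there exists a unique proper $L$-list coloring of $G$, then $$\sum_{i=1}^{n}\bigl(d_i-2(k_i-1)\bigr)\ge 0,$$ so the average degree of $G$ is at least $\frac{\sum_{i=1}^{n}2(k_i-1)}{n}$.
   Context: Graphs are finite and simple. A list assignment $L$ assigns to each vertex $v$ a finite set $L(v)$ of colors. A proper $L$-list coloring of $G$ is a map $c$ on $V(G)$ with $c(v)\in L(v)$ for all $v\in V(G)$ and $c(u)\ne c(v)$ for every edge $uv\in E(G)$. *)

(* Defs.v *)
From HB Require Import structures.
From mathcomp Require Import all_boot all_order all_algebra.
From mathcomp Require Import finmap.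

Set Implicit Arguments.
Unset Strict Implicit.
Unset Printing Implicit Defensive.

Import Order.TTheory GRing.Theory Num.Theory.
Local Open Scope ring_scope.

Record sgraph := SGraph {
  vertex :> finType;
  adj : rel vertex;
  adj_sym : symmetric adj;
  adj_irrefl : irreflexive adj
}.

Definition degree (G : sgraph) (v : G) : nat := #|[set w | adj v w]|.

(* For the graph without vertices this is 0, since division by 0 yields 0. *)
Definition average_degree (G : sgraph) : rat :=
  (\sum_(v : G) (degree v)%:R) / #|G|%:R.

(* Colors range over an arbitrary, possibly infinite, type; each list is a
   finite set of colors. *)
Definition list_assignment (G : sgraph) (C : choiceType) := G -> {fset C}.

(* Colorings are finite functions, so that Leibniz equality, used to express
   uniqueness, is pointwise equality. *)
Definition proper_list_coloring (G : sgraph) (C : choiceType)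
    (L : list_assignment G C) (c : {ffun G -> C}) : Prop :=
  (forall v : G, c v \in L v) /\ (forall u v : G, adj u v -> c u != c v).

(* Main.v *)
(** The polynomial [P = \prod_(uv edge) (x_u - x_v)] is nonzero at exactly one
    point of the grid [\prod_v L(v)]. For suitable nonzero weights [w_v] on
    [L(v)], the functional [Q |-> \sum_a (\prod_v w_v(a_v)) * Q(a)] over the grid
    kills every polynomial of degree less than [\sum_v (k_v - 1)], because such a
    monomial has exponent less than [k_v - 1] in some variable [x_v]. It does not
    kill [P], whose degree is the number of edges. *)
Require Import Defs.
From HB Require Import structures.
From mathcomp Require Import all_boot all_order all_algebra.
From mathcomp Require Import finmap.
From mathcomp Require Import ring.
Set Implicit Arguments.
Unset Strict Implicit.
Unset Printing Implicit Defensive.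
Import Order.TTheory GRing.Theory Num.Theory.
Local Open Scope ring_scope.

(** These are the barycentric weights of Lagrange interpolation at the nodes [x d] with [d] in [A].
    Extending them by 0 lets a sum over the grid run over all functions into [D]. *)
Definition lagrange_weight (F : fieldType) (D : finType) (x : D -> F)
    (A : {set D}) (d : D) : F :=
  if d \in A then (\prod_(b in A :\ d) (x d - x b))^-1 else 0.

Lemma lagrange_weight_neq0 (F : fieldType) (D : finType) (x : D -> F)
    (A : {set D}) (d : D) :
  injective x -> (lagrange_weight x A d != 0) = (d \in A).
Proof.
move=> x_inj; rewrite /lagrange_weight; case: ifP => [_|]; last by rewrite eqxx.
rewrite invr_eq0; apply/prodf_neq0 => b; rewrite !inE => /andP[b_neq_d _].
by rewrite subr_eq0 (inj_eq x_inj) eq_sym.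
Qed.

(* Compare the coefficients of degree [#|A| - 1] in the Lagrange interpolation
   formula for ['X^j]. *)
Lemma sum_lagrange_weight_exp (F : fieldType) (D : finType) (x : D -> F)
    (A : {set D}) (j : nat) :
  injective x -> (j < #|A|.-1)%N -> \sum_d lagrange_weight x A d * x d ^+ j = 0.
Proof.
move=> x_inj lt_j.
pose basis d : {poly F} := \prod_(b in A :\ d) ('X - (x b)%:P).
have size_basis d : d \in A -> size (basis d) = #|A|.
  move=> dA; rewrite /basis -big_enum size_prod_XsubC -cardE.
  by rewrite (cardsD1 d A) dA.
pose q := \sum_(d in A) (lagrange_weight x A d * x d ^+ j) *: basis d.
have size_q : (size q <= #|A|)%N.
  apply: (leq_trans (size_sum _ _ _)); apply/bigmax_leqP => d dA.
  by rewrite (leq_trans (size_scale_leq _ _)) ?size_basis.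
have q_root d : d \in A -> q.[x d] = x d ^+ j.
  move=> dA; rewrite horner_sum (bigD1 d) //= big1 ?addr0 => [|b /andP[bA b_neq_d]].
    rewrite hornerZ horner_prod mulrAC.
    have := lagrange_weight_neq0 A d x_inj.
    rewrite /lagrange_weight dA invr_eq0 => neq0.
    under [X in _ * X * _]eq_bigr => b _ do rewrite hornerXsubC.
    by rewrite mulVf ?mul1r.
  rewrite hornerZ horner_prod (bigD1 d) /=; last by rewrite !inE eq_sym b_neq_d.
  by rewrite hornerXsubC subrr mul0r mulr0.
have q_eq : 'X^j = q.
  apply/eqP; rewrite -subr_eq0; apply/eqP.
  apply: (@roots_geq_poly_eq0 _ _ [seq x d | d <- enum A]).
  - apply/allP => y /mapP[d]; rewrite mem_enum => dA ->.
    by rewrite rootE !hornerE q_root // subrr.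
  - by rewrite map_inj_uniq ?enum_uniq.
  - rewrite size_map -cardE (leq_trans (size_polyD _ _)) // geq_max size_polyN.
    by rewrite size_q size_polyXn (leq_trans lt_j) ?leq_pred.
move/(congr1 (fun p : {poly F} => p`_(#|A|.-1))): q_eq.
rewrite coefXn (gtn_eqF lt_j) coef_sum => /= eq0.
rewrite [RHS]eq0 (bigID (mem A)) /= [X in _ + X]big1 ?addr0; last first.
  by move=> d /negbTE dA; rewrite /lagrange_weight dA mul0r.
apply: eq_bigr => d dA; rewrite coefZ -(size_basis d dA).
have /monicP := monic_prod_XsubC (index_enum D) (mem (A :\ d)) x.
by rewrite /lead_coef => ->; rewrite mulr1.
Qed.

(** By distributivity the sum over the grid is a product of one-variable sums, one for each [v], and
    a single vanishing factor suffices. *)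
Lemma grid_sum_monomial (F : fieldType) (V D : finType) (x : D -> F)
    (w : V -> D -> F) (k e : V -> nat) :
  (forall v j, (j < k v)%N -> \sum_d w v d * x d ^+ j = 0) ->
  (\sum_v e v < \sum_v k v)%N ->
  \sum_(a : {ffun V -> D}) (\prod_v w v (a v)) * \prod_v x (a v) ^+ e v = 0.
Proof.
move=> w_exp lt_ek.
have [v lt_v] : exists v, (e v < k v)%N.
  apply/existsP; apply: contraLR lt_ek; rewrite negb_exists -leqNgt.
  by move=> /forallP le_ke; apply: leq_sum => v _; rewrite leqNgt.
under eq_bigr => a _ do rewrite -big_split /=.
rewrite -(bigA_distr_bigA (fun v d => w v d * x d ^+ e v)).
by rewrite (bigD1 v) //= w_exp ?mul0r.
Qed.

(** Induction on [E] expands the product one edge at a time. The monomial collects the variables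
    chosen so far, so [e] must vary while the total degree stays fixed. *)
Lemma grid_sum_edges (F : fieldType) (V D : finType) (x : D -> F)
    (w : V -> D -> F) (k e : V -> nat) (E : seq (V * V)) :
  (forall v j, (j < k v)%N -> \sum_d w v d * x d ^+ j = 0) ->
  (size E + \sum_v e v < \sum_v k v)%N ->
  \sum_(a : {ffun V -> D}) (\prod_v w v (a v)) *
    (\prod_(p <- E) (x (a p.1) - x (a p.2)) * \prod_v x (a v) ^+ e v) = 0.
Proof.
move=> w_exp; elim: E e => [|p E IHE] e.
  rewrite add0n => lt_ek; under eq_bigr => a _ do rewrite big_nil mul1r.
  exact: grid_sum_monomial lt_ek.
move=> lt_ek; pose e' u v := (e v + (v == u))%N.
have sum_e' u : (\sum_v e' u v = (\sum_v e v).+1)%N.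
  rewrite /e' big_split /= -addn1; congr (_ + _)%N.
  by rewrite (bigD1 u) //= eqxx big1 // => v /negbTE ->.
have mono_e' u (a : {ffun V -> D}) :
    \prod_v x (a v) ^+ e' u v = x (a u) * \prod_v x (a v) ^+ e v.
  under eq_bigr => v _ do rewrite exprD.
  rewrite big_split /= mulrC; congr (_ * _).
  by rewrite (bigD1 u) //= eqxx expr1 big1 ?mulr1 // => v /negbTE ->.
have IH u : (size E + \sum_v e' u v < \sum_v k v)%N by rewrite sum_e' addnS.
(* The factor of the edge [p] splits the sum into a difference of two sums with one exponent raised,
   and both vanish by induction. *)
have := f_equal2 (fun y z : F => y - z) (IHE _ (IH p.1)) (IHE _ (IH p.2)).
rewrite /= subr0 -sumrB; apply: etrans.
by apply: eq_bigr => a _; rewrite big_cons !mono_e'; ring.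
Qed.

(** Handshake lemma: ranking the vertices selects one orientation of each edge, and the adjacent
    pairs are the disjoint union of these and their swaps. *)
Lemma sum_degree (G : sgraph) :
  (\sum_(v : G) degree v =
   2 * #|[set p : G * G | adj p.1 p.2 && (enum_rank p.1 < enum_rank p.2)%N]|)%N.
Proof.
set E := [set p | _].
pose swap (p : G * G) := (p.2, p.1).
have swapK : involutive swap by case.
have -> : (\sum_(v : G) degree v = #|[set p : G * G | adj p.1 p.2]|)%N.
  rewrite -sum1_card (eq_bigl (fun p : G * G => adj p.1 p.2)) => [|p]; last by rewrite inE.
  rewrite -(pair_big_dep xpredT (fun v w : G => adj v w) (fun _ _ => 1%N)) /=.
  by apply: eq_bigr => v _; rewrite /degree -sum1_card; apply: eq_bigl => w; rewrite inE.
rewrite mul2n -addnn -{2}(card_imset E (inv_inj swapK)) -cardsUI.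
rewrite [X in (_ + X)%N](_ : _ = 0%N) ?addn0; last first.
  apply/eqP; rewrite cards_eq0 -subset0; apply/subsetP => p.
  rewrite !inE => /andP[/andP[_ lt_p]] /imsetP[[u v]].
  by rewrite !inE => /andP[_ lt_vu] p_eq; move: lt_p; rewrite p_eq ltnNge ltnW.
apply: eq_card => -[u v]; rewrite !inE -[(u, v)]swapK (mem_imset _ _ (inv_inj swapK)).
rewrite !inE /= (adj_sym v u) -andb_orr.
case uv: (adj u v) => //=; rewrite -neq_ltn; symmetry; apply/eqP => /val_inj.
by move=> /enum_rank_inj eq_uv; rewrite eq_uv adj_irrefl in uv.
Qed.

Lemma leq_sum_lists_degree (G : sgraph) (C : choiceType)
    (L : list_assignment G C) :
  (exists! c : {ffun G -> C}, proper_list_coloring L c) ->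
  (2 * \sum_(v : G) #|` L v|.-1 <= \sum_(v : G) degree v)%N.
Proof.
move=> [c [[c_list c_proper] c_uniq]]; rewrite sum_degree leq_mul2l /=.
set E := [set p | _]; rewrite leqNgt; apply/negP => lt_E.
(* [C] may be infinite, but only the finitely many listed colors matter. Numbering them embeds them
   in a field. *)
pose D := (\bigcup_(v <- enum G) L v)%fset.
have sub_LD v : (L v `<=` D)%fset.
  by apply: bigfcup_sup => //; rewrite mem_enum.
pose A v : {set D} := fsub D (L v).
pose x (d : D) : rat := (enum_rank d)%:R.
have x_inj : injective x.
  by move=> d d' /eqP; rewrite eqr_nat => /eqP /val_inj /enum_rank_inj.
pose c' : {ffun G -> D} := [ffun v => [` fsubsetP (sub_LD v) _ (c_list v)]%fset].
have c'E v : val (c' v) = c v by rewrite ffunE.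
have lt_sum : (size (enum E) + \sum_(v : G) 0 < \sum_(v : G) #|A v|.-1)%N.
  rewrite -cardE big1 // addn0; apply: leq_trans lt_E _.
  by apply: leq_sum => v _; rewrite /A card_fsub.
have /eqP := grid_sum_edges (fun v j => @sum_lagrange_weight_exp _ _ x (A v) j x_inj)
  lt_sum.
(* A nonzero term at [a] has nonzero weights, so [a] respects the lists, and nonzero edge factors,
   so it is proper. Uniqueness then forces [a = c']. *)
rewrite (bigD1 c') //= [X in _ + X]big1 ?addr0 => [|a]; last first.
  apply: contraNeq; rewrite !mulf_eq0 !negb_or => /and3P[wa Ea _].
  have {}wa v : val (a v) \in L v.
    move/prodf_neq0/(_ v isT): wa.
    by rewrite lagrange_weight_neq0 // in_fsub.
  pose c2 : {ffun G -> C} := [ffun v => val (a v)].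
  have c2_proper : proper_list_coloring L c2.
    split=> [v|]; first by rewrite ffunE.
    have lt_proper u v : adj u v -> (enum_rank u < enum_rank v)%N -> c2 u != c2 v.
      move=> uv lt_uv; move: Ea; rewrite prodf_seq_neq0 => /allP /(_ (u, v)).
      rewrite mem_enum inE /= uv lt_uv => /(_ isT).
      by rewrite subr_eq0 (inj_eq x_inj) !ffunE (inj_eq val_inj).
    move=> u v uv; case: (ltngtP (enum_rank u) (enum_rank v)) => [||/val_inj].
    - exact: lt_proper.
    - by rewrite eq_sym; apply: lt_proper; rewrite adj_sym.
    - by move/enum_rank_inj => eq_uv; rewrite eq_uv adj_irrefl in uv.
  apply/eqP/ffunP => v; apply: val_inj; rewrite c'E.
  by rewrite (c_uniq c2 c2_proper) ffunE.
apply/negP; rewrite !mulf_eq0 !negb_or; apply/and3P; split.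
- apply/prodf_neq0 => v _.
  by rewrite lagrange_weight_neq0 // in_fsub c'E.
- rewrite prodf_seq_neq0; apply/allP => -[u v].
  rewrite mem_enum inE /= => /andP[uv _].
  by rewrite subr_eq0 (inj_eq x_inj) -(inj_eq val_inj) !c'E c_proper.
- by apply/prodf_neq0 => v _; rewrite expr0 oner_eq0.
Qed.

Theorem theorem6 (G : sgraph) (C : choiceType) (L : list_assignment G C)
    (huniq : exists! c : {ffun G -> C}, proper_list_coloring L c) :
  0 <= \sum_(v : G) ((degree v)%:Z - 2 * (#|` L v|%:Z - 1)) /\
  (\sum_(v : G) 2 * (#|` L v|%:R - 1)) / #|G|%:R <= average_degree G.
Proof.
have le_sum := leq_sum_lists_degree huniq.
(* The coloring makes every list nonempty, so the truncated [.-1] agrees with true subtraction. *)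
have L_gt0 v : (0 < #|` L v|)%N.
  case: huniq => c [[c_list _] _]; rewrite cardfs_gt0.
  by apply/fset0Pn; exists (c v).
have natL (R : pzRingType) v : #|` L v|%:R - 1 = #|` L v|.-1%:R :> R.
  by rewrite -(prednK (L_gt0 v)) -natr1 addrK.
split.
  rewrite sumrB subr_ge0 -mulr_sumr.
  under eq_bigr => v _ do rewrite -natz natL.
  under [leRHS]eq_bigr => v _ do rewrite -natz.
  by rewrite -!natr_sum -natrM ler_nat.
(* Only nonnegativity of the inverse is used, so the graph without vertices, where it is 0, is
   covered too. *)
rewrite /average_degree ler_wpM2r ?invr_ge0 ?ler0n // -mulr_sumr.
under eq_bigr => v _ do rewrite natL.
by rewrite -!natr_sum -natrM ler_nat.
Qed.
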